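(* Let $q\in\mathbb{C}[x_1,\dotsc,x_d]$ be a polynomial of degree $l$ such that the ideal $J=\langle q\rangle$ generated by $q$ is radical. Let $L\in\mathbb{C}[x_1,\dotsc,x_d]$ be a polynomial such that the lowest degree of a monomial occurring in $L$ with non-zero coefficient is $l$ (the same $l$). If $\ker L(\mathbf{D})\cap J=\{0\}$, then for any polynomial $p\in\mathbb{C}[x_1,\dotsc,x_d]$ there exists a unique polynomial $f\in\ker L(\mathbf{D})$ such that $f|_{\mathcal{V}(J)}=p|_{\mathcal{V}(J)}$. Moreover, this $f$ is a polynomial of minimal degree among all polynomials in $\mathbb{C}[x_1,\dotsc,x_d]$ that coincide with $p$ on $\mathcal{V}(J)$.
   Context: For $L\in\mathbb{C}[x_1,\dotsc,x_d]$, $L(\mathbf{D})$ is the constant-coefficient differential operator obtained by formally replacing the variables $x_1,\dotsc,x_d$ in $L$ with the partial derivatives $D_1,\dotsc,D_d$ ($D_j=\partial/\partial x_j$), acting on $\mathbb{C}[x_1,\dotsc,x_d]$; $\ker L(\mathbf{D})=\{f\in\mathbb{C}[x_1,\dotsc,x_d]: L(\mathbf{D})f=0\}$. For an ideal $J$, $\mathcal{V}(J)=\{\mathbf{x}\in\mathbb{C}^d: g(\mathbf{x})=0\text{ for all }g\in J\}$. An ideal $J$ is radical if $f^r\in J$ for some positive integer $r$ implies $f\in J$. *)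

(* Defs.v *)
From mathcomp Require Import all_boot all_order all_algebra.
From mathcomp Require Import classical_sets reals complex mpoly.

Set Implicit Arguments.
Unset Strict Implicit.
Unset Printing Implicit Defensive.

Import GRing.Theory.
Local Open Scope ring_scope.
Local Open Scope classical_set_scope.

Section Definitions.
Variables (K : comNzRingType) (d : nat).

Implicit Types (L f g p q : {mpoly K[d]}).
Implicit Types (J : set {mpoly K[d]}) (V : set ('I_d -> K)).

(* [msize] is the total degree plus one, and 0 for the zero polynomial. *)
Definition has_degree q (l : nat) : Prop := msize q = l.+1.

Definition has_lowest_degree L (l : nat) : Prop :=
  (exists2 m, m \in msupp L & mdeg m = l) /\
  (forall m, m \in msupp L -> (l <= mdeg m)%N).

(* L(D), where [f^`M[m]] is D_1^(m_1) ... D_d^(m_d) f. *)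
Definition diffop L f : {mpoly K[d]} :=
  \sum_(m <- msupp L) L@_m *: f^`M[m].

Definition ker_diffop L : set {mpoly K[d]} := [set f | diffop L f = 0].

Definition principal_ideal q : set {mpoly K[d]} := [set h * q | h in setT].

Definition radical_ideal J : Prop :=
  forall f (r : nat), (0 < r)%N -> J (f ^+ r) -> J f.

Definition zero_locus J : set ('I_d -> K) :=
  [set x | forall g, J g -> g.@[x] = 0].

Definition coincide_on V f g : Prop := forall x, V x -> f.@[x] = g.@[x].

End Definitions.

(* Main.v *)
From HB Require Import structures.
Require Import Defs.
From mathcomp Require Import all_boot all_order all_algebra.
From mathcomp Require Import boolp classical_sets reals complex mpoly.

Set Implicit Arguments.
Unset Strict Implicit.
Unset Printing Implicit Defensive.

Import Order.TTheory GRing.Theory Num.Theory.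
Local Open Scope ring_scope.

(* The map h |-> L(D)(h q) is injective, and it preserves the space of
   polynomials of degree at most n because L(D) lowers the degree by at least
   l = deg q; hence it is bijective there. Solving L(D)(h q) = L(D)p for h of
   degree at most deg p - l gives f = p - h q, of degree at most deg p. For
   uniqueness, a difference of two solutions vanishes on V(q), so it lies in
   the radical ideal <q> by the Nullstellensatz. For a hypersurface the latter
   has a direct proof, by Euclidean division along a generic direction. *)

(** * Polynomials that vanish at every point *)

Lemma sum_digits_inj (b n : nat) (f g : 'I_n -> nat) :
    (forall i, f i < b)%N -> (forall i, g i < b)%N ->
    (\sum_(i < n) f i * b ^ i = \sum_(i < n) g i * b ^ i)%N ->
  f =1 g.
Proof.
elim: n f g => [|n IHn] f g ltfb ltgb; first by move=> _ [].
have split_sum (h : 'I_n.+1 -> nat) : (\sum_(i < n.+1) h i * b ^ i =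
    (\sum_(i < n) h (lift ord0 i) * b ^ i) * b + h ord0)%N.
  rewrite big_ord_recl expn0 muln1 addnC big_distrl /=; congr (_ + _)%N.
  by apply: eq_bigr => i _; rewrite expnSr mulnA.
rewrite !split_sum => eqfg.
have b_gt0 : (0 < b)%N := leq_ltn_trans (leq0n _) (ltfb ord0).
have eq0 : f ord0 = g ord0.
  by have := congr1 (modn^~ b) eqfg; rewrite /= !modnMDl !modn_small.
move: eqfg; rewrite eq0 => /addIn/eqP; rewrite eqn_pmul2r // => /eqP eqfg.
move=> i; case: (unliftP ord0 i) => [j ->|-> //].
by apply: (IHn (fun j => f (lift ord0 j)) (fun j => g (lift ord0 j))).
Qed.

(** In characteristic zero the naturals below [size p] are distinct roots, too many for a nonzero
    [p]. *)
Lemma horner_eq0_poly_eq0 (K : numDomainType) (p : {poly K}) :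
  (forall x, p.[x] = 0) -> p = 0.
Proof.
move=> p0; apply: (@roots_geq_poly_eq0 _ _ [seq i%:R | i <- iota 0 (size p)]).
- by apply/allP => x _; apply/rootP.
- by rewrite map_inj_uniq ?iota_uniq //; apply: mulrIn; rewrite oner_eq0.
- by rewrite size_map size_iota.
Qed.

(* Kronecker substitution x_i := t^(b^i), which separates monomials whose
   exponents are all below b. *)
Lemma meval_eq0_mpoly_eq0 (K : numDomainType) (n : nat) (p : {mpoly K[n]}) :
  (forall v, p.@[v] = 0) -> p = 0.
Proof.
move=> p0; pose b := msize p.
pose wt (m : 'X_{1..n}) := (\sum_(i < n) m i * b ^ i)%N.
pose P : {poly K} := \sum_(m <- msupp p) p@_m *: 'X^(wt m).
have P0 : P = 0.
  apply: horner_eq0_poly_eq0 => t; rewrite -(p0 (fun i => t ^+ (b ^ i))).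
  rewrite mevalE horner_sum; apply: eq_bigr => m _.
  rewrite hornerZ hornerXn; congr (_ * _).
  by rewrite /wt -prodrXr; apply: eq_bigr => i _; rewrite mulnC exprM.
have lt_supp m i : m \in msupp p -> (m i < b)%N.
  move=> /msize_mdeg_lt; apply: leq_ltn_trans.
  by rewrite mdegE (bigD1 i) //= leq_addr.
apply/eqP; rewrite -msupp_eq0; apply: contraT.
case E: (msupp p) => [//|m s] _.
have m_supp : m \in msupp p by rewrite E mem_head.
(* By uniqueness of digits, no other monomial of the support has the weight of [m], so this
   coefficient is [p@_m] alone. *)
have := congr1 (fun Q : {poly K} => Q`_(wt m)) P0.
rewrite coef0 coef_sum (bigD1_seq m) ?msupp_uniq //=.
rewrite coefZ coefXn eqxx mulr1 big_seq_cond big1 => [|m' /andP[m'_supp neq]].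
  by rewrite addr0 => /eqP; rewrite mcoeff_eq0 m_supp.
rewrite coefZ coefXn; case: eqP => [eq_wt|]; last by rewrite mulr0.
case/eqP: neq; apply/mnmP; apply: (@sum_digits_inj b) => [i|i|//];
  exact: lt_supp.
Qed.

(** * Nullstellensatz for a hypersurface, by restriction to lines *)

(** Up to a unit, [p] is a product of [(size p).-1] linear factors, and each of them divides one
    copy of [g]. *)
Lemma dvdp_exp_roots (K : closedFieldType) (p g : {poly K}) :
  (forall z, root p z -> root g z) -> p != 0 -> p %| g ^+ (size p).-1.
Proof.
move=> pg p_neq0; have [r Ep] := closed_field_poly_normal p.
have lc_neq0 : lead_coef p != 0 by rewrite lead_coef_eq0.
have r_root : all (root g) r.
  by apply/allP => z zr; apply: pg; rewrite Ep rootZ // root_prod_XsubC.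
have -> : (size p).-1 = size r by rewrite Ep size_scale // size_prod_XsubC.
rewrite Ep dvdpZl //; move: {Ep} r_root.
elim: r => [|z r IHr]; first by rewrite big_nil dvd1p.
move=> /= /andP[gz gr]; rewrite big_cons exprS dvdp_mul ?IHr //.
by rewrite -root_factor_theorem.
Qed.

Section Line.
Variables (K : comNzRingType) (d : nat) (v : 'I_d -> K).

(* [line p] is p (x + t v), as a polynomial in t over K[x]. *)
Definition line : {mpoly K[d]} -> {poly {mpoly K[d]}} :=
  mmap (polyC \o @mpolyC d K) (fun i => ('X_i)%:P + (v i)%:MP *: 'X).

Lemma lineE p : line p = \sum_(m <- msupp p)
  (p@_m)%:MP *: \prod_(i < d) (('X_i)%:P + (v i)%:MP *: 'X) ^+ m i.
Proof. by apply: eq_bigr => m _; rewrite mul_polyC. Qed.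

Lemma line_at0 p : (line p).[0] = p.
Proof.
rewrite lineE horner_sum [RHS]mpolyE; apply: eq_bigr => m _.
rewrite hornerZ horner_prod mul_mpolyC mpolyXE_id; congr (_ *: _).
by apply: eq_bigr => i _; rewrite !hornerE.
Qed.

Lemma horner_map_line p a t :
  (map_poly (meval a) (line p)).[t] = p.@[fun i => a i + v i * t].
Proof.
rewrite lineE rmorph_sum horner_sum mevalE; apply: eq_bigr => m _.
rewrite /= map_polyZ /= mevalC hornerZ; congr (_ * _).
rewrite rmorph_prod horner_prod; apply: eq_bigr => i _.
rewrite rmorphXn rmorphD /= map_polyC map_polyZ map_polyX /=.
by rewrite mevalC mevalXU !hornerE.
Qed.

End Line.

Section BoundedLead.
Variables (K : comNzRingType) (d : nat).

(** Here [c] may be zero, so [n] only bounds the degree in t. This makes the notion stable under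
    products, and under sums for a fixed [n], without any cancellation condition. *)
Definition bounded_lead (n : nat) (c : K) (P : {poly {mpoly K[d]}}) :=
  (size P <= n.+1)%N /\ P`_n = c%:MP.

Lemma bounded_leadM n1 n2 c1 c2 P1 P2 : bounded_lead n1 c1 P1 ->
  bounded_lead n2 c2 P2 -> bounded_lead (n1 + n2) (c1 * c2) (P1 * P2).
Proof.
move=> [s1 l1] [s2 l2]; split.
  apply: leq_trans (size_polyMleq _ _) _.
  by rewrite -subn1 leq_subLR add1n -addnS -addSn leq_add.
have lt1 : (n1 < (n1 + n2).+1)%N by rewrite ltnS leq_addr.
rewrite coefM (bigD1 (Ordinal lt1)) //= addKn l1 l2 -mpolyCM big1 ?addr0 //.
move=> i; rewrite -val_eqE /= neq_ltn => /orP[lt_i|lt_i].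
  rewrite [P2`__]nth_default ?mulr0 //; apply: leq_trans s2 _.
  by rewrite ltn_subRL ltn_add2r.
by rewrite nth_default ?mul0r //; apply: leq_trans s1 _.
Qed.

Lemma bounded_lead1 : bounded_lead 0 1 1.
Proof. by split; rewrite ?size_poly1 // coef1. Qed.

Lemma bounded_lead_lineX (v : 'I_d -> K) m :
  bounded_lead (mdeg m) (\prod_(i < d) v i ^+ m i)
    (\prod_(i < d) (('X_i)%:P + (v i)%:MP *: 'X) ^+ m i).
Proof.
rewrite mdegE.
apply: (big_ind3 (fun n c P => bounded_lead n c P)) => [||i _].
- exact: bounded_lead1.
- by move=> *; apply: bounded_leadM.
- elim: (m i) => [|k IHk]; first exact: bounded_lead1.
rewrite !exprS -add1n; apply: bounded_leadM => //; split.
  rewrite (leq_trans (size_polyD _ _)) // geq_max size_polyC.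
  by rewrite (leq_trans (leq_b1 _)) // (leq_trans (size_scale_leq _ _)) //
    size_polyX.
  by rewrite coefD coefC coefZ coefX mulr1 add0r.
Qed.

(** Only monomials of degree [l] reach t^l in q(x + t v), and each contributes its value at [v],
    free of x. *)
Lemma bounded_lead_line (l : nat) (v : 'I_d -> K) (q : {mpoly K[d]}) :
    (msize q <= l.+1)%N ->
  bounded_lead l (pihomog mdeg l q).@[v] (line v q).
Proof.
move=> size_q; rewrite lineE /pihomog raddf_sum.
rewrite [in X in bounded_lead _ X]big_mkcond /=.
rewrite big_seq [X in bounded_lead _ _ X]big_seq.
apply: (big_ind2 (fun c P => bounded_lead l c P)) => [||m m_supp].
- by split; rewrite ?size_poly0 // coef0.
- move=> c1 P1 c2 P2 [s1 l1] [s2 l2]; split.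
    by rewrite (leq_trans (size_polyD _ _)) // geq_max s1.
  by rewrite coefD l1 l2 mpolyCD.
have [sX lX] := bounded_lead_lineX v m.
have le_ml : (mdeg m <= l)%N.
  by rewrite -ltnS (leq_trans (msize_mdeg_lt m_supp)).
split; first by rewrite (leq_trans (size_scale_leq _ _)) // (leq_trans sX).
rewrite coefZ; case: eqP => [<-|/eqP ne_ml].
  by rewrite lX mevalZ mevalX mpolyCM.
by rewrite nth_default ?mulr0 // (leq_trans sX) // ltn_neqAle ne_ml.
Qed.

End BoundedLead.

(** The monomial order refines the degree, so the leading monomial of [q] survives in the top
    form. *)
Lemma pihomog_msize_neq0 (K : nzRingType) (d l : nat) (q : {mpoly K[d]}) :
  msize q = l.+1 -> pihomog mdeg l q != 0.
Proof.
move=> size_q; have q_neq0 : q != 0 by rewrite -msize_poly_eq0 size_q.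
apply/eqP => /(congr1 (mcoeff (mlead q))); rewrite /pihomog big_mkcond /=.
rewrite (bigD1_seq (mlead q)) ?msupp_uniq ?mlead_supp //=.
rewrite -eqSS mlead_deg // size_q eqxx mcoeff0 mcoeffD mcoeffZ mcoeffX eqxx.
rewrite mulr1 raddf_sum big1 /= ?addr0 => [|m m_neq].
  by apply/eqP; rewrite mleadc_eq0.
case: ifP => _; last by rewrite mcoeff0.
by rewrite mcoeffZ mcoeffX (negPf m_neq) mulr0.
Qed.

(* If Q is [line v q] with v off the zero set of the top form of q, then Q is
   monic in t up to a unit. In g(x + t v)^l = Q * H + r the remainder vanishes
   at every x = a, as Q(a, t) divides g(a + t v)^l; take t = 0. *)
Theorem hypersurface_Nullstellensatz (K : numClosedFieldType) (d l : nat)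
    (q g : {mpoly K[d]}) : msize q = l.+1 ->
  (forall x, q.@[x] = 0 -> g.@[x] = 0) -> exists h, g ^+ l = h * q.
Proof.
move=> size_q qg.
have [v top_v] : exists v, (pihomog mdeg l q).@[v] != 0.
  apply: contrapT => no_v; have /eqP[] := pihomog_msize_neq0 size_q.
  apply: meval_eq0_mpoly_eq0 => v; apply: contrapT => top_v.
  by apply: no_v; exists v; apply/eqP.
pose Q := line v q; pose G := line v g.
have [sQ lQ] : bounded_lead l (pihomog mdeg l q).@[v] Q.
  by apply: bounded_lead_line; rewrite size_q.
have coef_neq0 : Q`_l != 0 by rewrite lQ mpolyC_eq0.
have {}sQ : size Q = l.+1.
  apply/eqP; rewrite eqn_leq sQ ltnNge.
  by apply: contra coef_neq0 => /leq_sizeP ->.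
(* A nonzero constant is invertible in K[x], which permits Euclidean division by [Q] over that
   ring. *)
have lcQ_unit : lead_coef Q \is a GRing.unit.
  by rewrite /lead_coef sQ lQ rmorph_unit // unitfE.
have Q_neq0 : Q != 0 by rewrite -size_poly_eq0 sQ.
have G0 : G.[0] = g by exact: (line_at0 v g).
have Q0 : Q.[0] = q by exact: (line_at0 v q).
have hornerG a t : (map_poly (meval a) G).[t] = g.@[fun i => a i + v i * t].
  exact: horner_map_line.
have hornerQ a t : (map_poly (meval a) Q).[t] = q.@[fun i => a i + v i * t].
  exact: horner_map_line.
(* The leading coefficient does not depend on x, so no specialization x = a lowers the degree of
   [Q]. *)
have Qa_lead a : meval a (lead_coef Q) != 0.
  by rewrite /lead_coef sQ /= lQ mevalC.
(* Unification would otherwise unfold [line] and diverge. *)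
move: Q G lQ coef_neq0 sQ lcQ_unit Q_neq0 G0 Q0 hornerG hornerQ Qa_lead.
move=> Q G _ _ sQ lcQ_unit Q_neq0 G0 Q0 hornerG hornerQ Qa_lead.
have [H [r [EG sr]]] : exists H r, G ^+ l = H * Q + r /\ (size r < l.+1)%N.
  exists (G ^+ l %/ Q), (G ^+ l %% Q); rewrite -sQ ltn_modpN0 //.
  by rewrite -Pdiv.IdomainUnit.divp_eq.
suff r0 : r = 0.
  exists H.[0].
  have := congr1 (horner^~ 0) EG; rewrite /= r0 addr0.
  by rewrite horner_exp hornerM G0 Q0.
apply/polyP => i; rewrite coef0; apply: meval_eq0_mpoly_eq0 => a.
rewrite -coef_map /=; suff -> : map_poly (meval a) r = 0 by rewrite coef0.
have sQa : size (map_poly (meval a) Q) = l.+1 by rewrite size_map_poly_id0.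
have Qa_dvd : map_poly (meval a) Q %| (map_poly (meval a) G) ^+ l.
  rewrite -[l in _ ^+ l]/(l.+1.-1) -sQa; apply: dvdp_exp_roots.
    by move=> z; rewrite !rootE hornerG hornerQ => /eqP /qg /eqP.
  by rewrite -size_poly_eq0 sQa.
move: Qa_dvd; rewrite -rmorphXn EG rmorphD rmorphM /= dvdp_addr ?dvdp_mull //.
move=> r_dvd; apply/eqP; apply: contraTT r_dvd => r_neq0.
apply/negP => /(dvdp_leq r_neq0); rewrite sQa leqNgt.
by rewrite (leq_ltn_trans (size_poly _ _)).
Qed.

(** * Degree bounds and solvability for L(D) *)

Lemma msize_leqP (K : nzRingType) (d n : nat) (p : {mpoly K[d]}) :
  reflect (forall m, (n <= mdeg m)%N -> p@_m = 0) (msize p <= n)%N.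
Proof.
apply: (iffP idP) => [le_pn m le_nm | p0].
  by apply: memN_msupp_eq0; apply: msize_mdeg_ge; apply: leq_trans le_nm.
rewrite msizeE; apply/bigmax_leqP_seq => m m_supp _; rewrite ltnNge.
by apply: contraL m_supp => /p0/eqP; rewrite -mcoeff_eq0.
Qed.

Section DiffOp.
Variables (K : comNzRingType) (d : nat) (L : {mpoly K[d]}).

Lemma diffop_is_linear : linear (diffop L).
Proof.
move=> c f g; rewrite /diffop scaler_sumr -big_split /=.
apply: eq_bigr => m _; rewrite linearP /= scalerDr !scalerA.
by rewrite [_ * c]mulrC.
Qed.

HB.instance Definition _ := GRing.isLinear.Build K {mpoly K[d]} {mpoly K[d]} _
  (diffop L) diffop_is_linear.

(** The coefficient of L(D)g at [m] only involves those of [g] at [m + k] with [k] in the support of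
    [L]. For [n = 0] this says that L(D) kills degrees below [l]. *)
Lemma msize_diffop l n g : has_lowest_degree L l -> (msize g <= n + l)%N ->
  (msize (diffop L g) <= n)%N.
Proof.
move=> [_ L_low] /msize_leqP g0; apply/msize_leqP => m le_nm.
rewrite /diffop raddf_sum /= big_seq big1 // => k /L_low le_lk.
rewrite mcoeffZ mcoeff_mderivm g0 ?mul0rn ?mulr0 //.
by rewrite mdegD addnC leq_add.
Qed.

End DiffOp.

(** An injective endomorphism of a finite-dimensional space is onto; [enc] and [dec] transport this
    from the space of coefficient vectors. *)
Lemma msize_bounded_surj (K : fieldType) (d n : nat)
    (T : {linear {mpoly K[d]} -> {mpoly K[d]}}) :
    (forall p, (msize p <= n)%N -> (msize (T p) <= n)%N) ->
    (forall p, (msize p <= n)%N -> T p = 0 -> p = 0) ->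
  forall g, (msize g <= n)%N -> exists2 p, (msize p <= n)%N & T p = g.
Proof.
move=> T_bound T_inj g g_bound.
pose V : vectType K := {ffun 'X_{1..d < n} -> K^o}.
pose enc (u : V) : {mpoly K[d]} := \sum_(m : 'X_{1..d < n}) u m *: 'X_[m].
pose dec (p : {mpoly K[d]}) : V := [ffun m : 'X_{1..d < n} => p@_m].
have enc_bound u : (msize (enc u) <= n)%N.
  apply/msize_leqP => m le_nm; rewrite /enc raddf_sum /= big1 // => k _.
  rewrite mcoeffZ mcoeffX; case: eqP => [Ek|]; last by rewrite mulr0.
  by have := bmdeg k; rewrite Ek ltnNge le_nm.
have decK p : (msize p <= n)%N -> enc (dec p) = p.
  move=> p_bound; rewrite [RHS](mpolywE p_bound).
  by apply: eq_bigr => m _; rewrite ffunE.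
have dec_inj p1 p2 : (msize p1 <= n)%N -> (msize p2 <= n)%N ->
    dec p1 = dec p2 -> p1 = p2.
  by move=> b1 b2 /(congr1 enc); rewrite !decK.
have enc0 u : enc u = 0 -> u = 0.
  move=> Eu; apply/ffunP => m; rewrite ffunE.
  have := congr1 (mcoeff m) Eu; rewrite mcoeff0 raddf_sum /= (bigD1 m) //=.
  rewrite mcoeffZ mcoeffX eqxx mulr1 big1 ?addr0 // => k neq_km.
  rewrite mcoeffZ mcoeffX; case: eqP => [/val_inj/eqP|]; last by rewrite mulr0.
  by rewrite (negPf neq_km).
have f_linear : linear (fun u => dec (T (enc u))).
  move=> c u v; have -> : enc (c *: u + v) = c *: enc u + enc v.
    rewrite /enc scaler_sumr -big_split; apply: eq_bigr => m _.
    by rewrite !ffunE scalerDl scalerA.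
  by rewrite linearP; apply/ffunP => m; rewrite !ffunE mcoeffD mcoeffZ.
pose f0 : {linear V -> V} := HB.pack (fun u => dec (T (enc u)))
  (GRing.isLinear.Build K V V _ _ f_linear).
pose f : 'End(V) := linfun f0.
have fE u : f u = dec (T (enc u)) by rewrite lfunE.
have f_ker0 : lker f == 0%VS.
  apply/lker0P => u v /eqP; rewrite -subr_eq0 -linearB /= fE => /eqP Euv.
  apply/eqP; rewrite -subr_eq0; apply/eqP/enc0/T_inj => //.
  apply: dec_inj; rewrite ?T_bound ?msize0 // Euv.
  by apply/ffunP => m; rewrite !ffunE mcoeff0.
exists (enc (f^-1%VF (dec g))) => //.
by apply: dec_inj; rewrite ?T_bound // -fE lker0_lfunVK.
Qed.

Lemma msizeM_leq_pred (K : idomainType) (d : nat) (p q : {mpoly K[d]}) :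
  (msize (p * q) <= (msize p + msize q).-1)%N.
Proof.
have [->|p_neq0] := eqVneq p 0; first by rewrite mul0r msize0.
have [->|q_neq0] := eqVneq q 0; first by rewrite mulr0 msize0.
by rewrite msizeM.
Qed.

(** The size bound is what later gives minimality, when this is applied to a competitor of the
    solution. *)
Lemma ker_diffop_representative (K : fieldType) (d l : nat)
    (q L p : {mpoly K[d]}) :
    has_degree q l -> has_lowest_degree L l ->
    (forall h, diffop L (h * q) = 0 -> h = 0) ->
  exists h, diffop L (p - h * q) = 0 /\ (msize (p - h * q) <= msize p)%N.
Proof.
move=> q_deg L_deg Lq_inj; pose n := (msize p - l)%N.
have le_hq m (h : {mpoly K[d]}) : (msize h <= m)%N ->
    (msize (h * q) <= m + l)%N.
  move=> le_hm; apply: leq_trans (msizeM_leq_pred _ _) _.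
  by rewrite q_deg addnS leq_add2r.
have T_linear : linear (fun h => diffop L (h * q)).
  by move=> c h k; rewrite mulrDl -scalerAl linearP.
pose T : {linear {mpoly K[d]} -> {mpoly K[d]}} :=
  HB.pack (fun h => diffop L (h * q))
    (GRing.isLinear.Build K {mpoly K[d]} {mpoly K[d]} _ _ T_linear).
have [h|h _||h le_hn Th] := @msize_bounded_surj _ _ n T _ _ (diffop L p).
- by move=> le_hn; apply: msize_diffop L_deg _; apply: le_hq.
- exact: Lq_inj.
- by apply: msize_diffop L_deg _; rewrite addnC -leq_subLR.
exists h; split; first by rewrite linearB /= [diffop L (h * q)]Th subrr.
apply: leq_trans (msizeD_le _ _) _; rewrite geq_max leqnn msizeN /=.
have [->|h_neq0] := eqVneq h 0; first by rewrite mul0r msize0.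
apply: leq_trans (le_hq _ _ le_hn) _; rewrite subnK // ltnW // -subn_gt0.
by apply: leq_trans le_hn; rewrite lt0n msize_poly_eq0.
Qed.

Local Open Scope classical_set_scope.

Theorem theorem3p2 (R : realType) (d l : nat) (q L : {mpoly R[i][d]})
    (q_deg : has_degree q l)
    (J_radical : radical_ideal (principal_ideal q))
    (L_deg : has_lowest_degree L l)
    (kerL_J : ker_diffop L `&` principal_ideal q = [set 0])
    (p : {mpoly R[i][d]}) :
  exists f : {mpoly R[i][d]},
    unique (fun g => ker_diffop L g /\
                     coincide_on (zero_locus (principal_ideal q)) g p) f /\
    (forall g, coincide_on (zero_locus (principal_ideal q)) g p ->
               (msize f <= msize g)%N).
Proof.
have q_neq0 : q != 0 by rewrite -msize_poly_eq0 q_deg.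
have locusP x : zero_locus (principal_ideal q) x <-> q.@[x] = 0.
  split=> [|qx _ [h _ <-]]; last by rewrite mevalM qx mulr0.
  by apply; exists 1; rewrite ?mul1r.
have ker_ideal0 g : diffop L g = 0 -> principal_ideal q g -> g = 0.
  by move=> Lg Jg; have : [set 0] g by rewrite -kerL_J.
have Lq_inj h : diffop L (h * q) = 0 -> h = 0.
  move=> Lhq; have /eqP : h * q = 0 by apply: ker_ideal0 => //; exists h.
  by rewrite mulf_eq0 (negPf q_neq0) orbF => /eqP.
have coincideP g1 g2 : coincide_on (zero_locus (principal_ideal q)) g1 g2 ->
    principal_ideal q (g1 - g2).
  move=> Eg.
  have [|h Eh] := @hypersurface_Nullstellensatz _ d l q (g1 - g2) q_deg.
    by move=> x /locusP/Eg; rewrite mevalB => ->; rewrite subrr.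
  apply: (J_radical _ l.+1) => //; exists ((g1 - g2) * h) => //.
  by rewrite exprS Eh mulrA.
have coincide_subM g h :
    coincide_on (zero_locus (principal_ideal q)) (g - h * q) g.
  by move=> x /locusP qx; rewrite mevalB mevalM qx mulr0 subr0.
have ker_unique g1 g2 : diffop L g1 = 0 -> diffop L g2 = 0 ->
    coincide_on (zero_locus (principal_ideal q)) g1 g2 -> g1 = g2.
  move=> Lg1 Lg2 /coincideP Jg; apply/eqP; rewrite -subr_eq0; apply/eqP.
  by apply: ker_ideal0 => //; rewrite linearB /= Lg1 Lg2 subrr.
have [h [Lf _]] := ker_diffop_representative p q_deg L_deg Lq_inj.
exists (p - h * q); split.
  split=> [|g [Lg Eg]]; first by split=> //; apply: coincide_subM.
  by apply: ker_unique => // x Vx; rewrite Eg // coincide_subM.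
move=> g Eg.
have [k [Lk le_kg]] := ker_diffop_representative g q_deg L_deg Lq_inj.
suff -> : p - h * q = g - k * q by [].
by apply: ker_unique => // x Vx; rewrite (coincide_subM p) //
  (coincide_subM g) // Eg.
Qed.
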